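(* Let $(\mathcal M_1',\mathcal W_1')$, $(\mathcal M_1,\mathcal W_1)$, $(\mathcal M_2,\mathcal W_2)$ be three categories with weak equivalences and let $\mathcal M_1'\xrightarrow{t}\mathcal M_1\xrightarrow{u}\mathcal M_2$ be two functors. (1) If $t$ is a left approximation and $ut$ preserves weak equivalences, then $u$ admits a total left derived functor $(\mathbf Lu,\epsilon)$. The natural map $\epsilon:(\mathbf Lu)(tA')\to utA'$ is an isomorphism (in $\mathbf{ho}\mathcal M_2$) for all objects $A'$ of $\mathcal M_1'$. (2) If $t$ is a right approximation and $ut$ preserves weak equivalences, then $u$ admits a total right derived functor $(\mathbf Ru,\eta)$. The natural map $\eta:utA'\to(\mathbf Ru)(tA')$ is an isomorphism (in $\mathbf{ho}\mathcal M_2$) for all objects $A'$ of $\mathcal M_1'$.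
   Context: Categories with weak equivalences here are category pairs: a category $\mathcal M$ with a class $\mathcal W$ of maps (weak equivalences) stable under composition and containing all identity maps. $\gamma_{\mathcal M}:\mathcal M\to\mathbf{ho}\mathcal M=\mathcal M[\mathcal W^{-1}]$ is the localization. A category pair functor $t:(\mathcal M',\mathcal W')\to(\mathcal M,\mathcal W)$ is a functor with $t(\mathcal W')\subset\mathcal W$. A category pair functor $t$ is a left approximation if: LAP1: for any object $A\in\mathcal M$ there are an object $A'\in\mathcal M'$ and a weak equivalence $tA'\to A$. LAP2: for any objects $A',B'\in\mathcal M'$, $B\in\mathcal M$, any map $f:tA'\to B$ in $\mathcal M$ and any $p:tB'\to B$ in $\mathcal W$: (1) there exist maps $i':A'\to D'$ and $j':B'\to D'$ in $\mathcal M'$ with $j'\in\mathcal W'$, and a weak equivalence $\sigma:tD'\to B$ in $\mathcal W$, with $\sigma\circ ti'=f$ and $\sigma\circ tj'=p$; (2) for any other such $i'',j'',\sigma''$ (with some object $D''$), one has $j'^{-1}i'=j''^{-1}i''$ in $\mathbf{ho}\mathcal M'$. It is a right approximation if the dual conditions hold: RAP1: for any $A\in\mathcal M$ there are $A'\in\mathcal M'$ and a weak equivalence $A\to tA'$. RAP2: for any $f:A\to tB'$ in $\mathcal M$ and $i:A\to tA'$ in $\mathcal W$: (1) there exist maps $q':S'\to A'$, $p':S'\to B'$ in $\mathcal M'$ with $q'\in\mathcal W'$ and a weak equivalence $\tau:A\to tS'$ with $tq'\circ\tau=i$, $tp'\circ\tau=f$; (2) for any other such $p'',q'',\tau''$,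 one has $p'q'^{-1}=p''q''^{-1}$ in $\mathbf{ho}\mathcal M'$. The total left derived functor of $u:\mathcal M_1\to\mathcal M_2$ is a pair $(\mathbf Lu,\epsilon)$ of a functor $\mathbf Lu:\mathbf{ho}\mathcal M_1\to\mathbf{ho}\mathcal M_2$ and a natural map $\epsilon:\mathbf Lu\circ\gamma_{\mathcal M_1}\Rightarrow\gamma_{\mathcal M_2}u$ which is terminal: for any functor $\Lambda:\mathbf{ho}\mathcal M_1\to\mathbf{ho}\mathcal M_2$ and natural map $\lambda:\Lambda\gamma_{\mathcal M_1}\Rightarrow\gamma_{\mathcal M_2}u$ there is a unique $\delta:\Lambda\Rightarrow\mathbf Lu$ with $\epsilon\circ(\delta\gamma_{\mathcal M_1})=\lambda$. Dually, the total right derived functor is the initial pair $(\mathbf Ru,\eta)$ with $\eta:\gamma_{\mathcal M_2}u\Rightarrow\mathbf Ru\circ\gamma_{\mathcal M_1}$. *)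

(* Defs.v *)
From Stdlib Require Import FunctionalExtensionality PropExtensionality.
From Stdlib Require Import ProofIrrelevance ClassicalEpsilon.

Set Implicit Arguments.
Unset Strict Implicit.
Unset Printing Implicit Defensive.

(* Equality of morphisms is Leibniz equality. Nothing is assumed locally small:
   the construction of [ho] below makes the universe of [hom] at least as large
   as that of [Ob], so that M and M[W^-1] are categories of the same kind. *)
Record Category := {
  Ob :> Type;
  hom : Ob -> Ob -> Type;
  idm : forall A, hom A A;
  comp : forall A B C, hom B C -> hom A B -> hom A C;
  comp_idl : forall A B (f : hom A B), comp (idm B) f = f;
  comp_idr : forall A B (f : hom A B), comp f (idm A) = f;
  comp_assoc : forall A B C D (h : hom C D) (g : hom B C) (f : hom A B),
    comp h (comp g f) = comp (comp h g) f }.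

Arguments hom {c} A B.
Arguments idm {c} A.
Arguments comp {c A B C} g f.

Declare Scope cat_scope.
Delimit Scope cat_scope with cat.
Open Scope cat_scope.
Notation "g ∘ f" := (comp g f) (at level 40, left associativity) : cat_scope.

Definition is_iso (C : Category) (A B : C) (f : hom A B) : Prop :=
  exists g : hom B A, g ∘ f = idm A /\ f ∘ g = idm B.

Record Functor (C D : Category) := {
  fobj :> C -> D;
  fmap : forall A B : C, hom A B -> hom (fobj A) (fobj B);
  fmap_id : forall A : C, fmap (idm A) = idm (fobj A);
  fmap_comp : forall (A B E : C) (g : hom B E) (f : hom A B),
    fmap (g ∘ f) = fmap g ∘ fmap f }.

Arguments fmap {C D} f {A B} _ : rename.

Definition fcomp (C D E : Category) (G : Functor D E) (F : Functor C D) :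
  Functor C E.
Proof.
refine {| fobj A := G (F A); fmap A B f := fmap G (fmap F f) |}.
- intros A; rewrite !fmap_id; reflexivity.
- intros A B K g f; rewrite !fmap_comp; reflexivity.
Defined.

Record NatTrans (C D : Category) (F G : Functor C D) := {
  component :> forall A : C, hom (F A) (G A);
  naturality : forall (A B : C) (f : hom A B),
    component B ∘ fmap F f = fmap G f ∘ component A }.

Definition vcomp (C D : Category) (F G H : Functor C D)
  (b : NatTrans G H) (a : NatTrans F G) : NatTrans F H.
Proof.
refine {| component A := b A ∘ a A |}.
intros A B f.
rewrite <- comp_assoc, naturality, comp_assoc, naturality, comp_assoc.
reflexivity.
Defined.

Definition whisker (C D E : Category) (G H : Functor D E)
  (d : NatTrans G H) (F : Functor C D) : NatTrans (fcomp G F) (fcomp H F).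
Proof.
refine {| component A := d (F A) : hom (fcomp G F A) (fcomp H F A) |}.
intros A B f; exact (naturality d (fmap F f)).
Defined.

Lemma NatTrans_ext (C D : Category) (F G : Functor C D) (a b : NatTrans F G) :
  (forall A, a A = b A) -> a = b.
Proof.
destruct a as [a na], b as [b nb]; simpl; intros e.
assert (e' : a = b) by (apply functional_extensionality_dep; exact e).
subst b; f_equal; apply proof_irrelevance.
Qed.

(* Neither two-out-of-three nor the presence of
   all isomorphisms is required of weak equivalences. *)
Record CatPair := {
  cat_of :> Category;
  weq : forall A B : cat_of, hom A B -> Prop;
  weq_id : forall A : cat_of, weq (idm A);
  weq_comp : forall (A B C : cat_of) (g : hom B C) (f : hom A B),
    weq g -> weq f -> weq (g ∘ f) }.

Arguments weq {c A B} _.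

Definition preserves_weq (M N : CatPair) (F : Functor M N) : Prop :=
  forall (A B : M) (w : hom A B), weq w -> weq (fmap F w).

(* The localization M[W^-1], presented by generators and relations: same
   objects as M, morphisms the formal composites of maps of M and of formal
   inverses of weak equivalences, modulo the congruence [word_eq]. Lemma
   [ho_universal] below is its universal property. *)
Inductive word (M : CatPair) : M -> M -> Type :=
| word_id A : word A A
| word_comp A B C : word B C -> word A B -> word A C
| word_map A B : hom A B -> word A B
| word_inv A B (w : hom A B) : weq w -> word B A.

Inductive word_eq (M : CatPair) : forall A B : M, word A B -> word A B -> Prop :=
| word_eq_refl A B (x : word A B) : word_eq x x
| word_eq_sym A B (x y : word A B) : word_eq x y -> word_eq y x
| word_eq_trans A B (x y z : word A B) :
    word_eq x y -> word_eq y z -> word_eq x z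
| word_eq_cong A B C (x x' : word B C) (y y' : word A B) :
    word_eq x x' -> word_eq y y' -> word_eq (word_comp x y) (word_comp x' y')
| word_eq_idl A B (x : word A B) : word_eq (word_comp (word_id B) x) x
| word_eq_idr A B (x : word A B) : word_eq (word_comp x (word_id A)) x
| word_eq_assoc A B C D (x : word C D) (y : word B C) (z : word A B) :
    word_eq (word_comp x (word_comp y z)) (word_comp (word_comp x y) z)
| word_eq_map_id A : word_eq (word_map (idm A)) (word_id A)
| word_eq_map_comp A B C (g : hom B C) (f : hom A B) :
    word_eq (word_map (g ∘ f)) (word_comp (word_map g) (word_map f))
| word_eq_invl A B (w : hom A B) (Hw : weq w) :
    word_eq (word_comp (word_inv Hw) (word_map w)) (word_id A)
| word_eq_invr A B (w : hom A B) (Hw : weq w) :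
    word_eq (word_comp (word_map w) (word_inv Hw)) (word_id B).

(* Quotient of [word A B]: an element is an equivalence class, as a predicate. *)
Definition ho_hom (M : CatPair) (A B : M) : Type :=
  { P : word A B -> Prop | exists x, P = word_eq x }.

Definition ho_class (M : CatPair) (A B : M) (x : word A B) : ho_hom A B :=
  exist _ (word_eq x) (ex_intro _ x eq_refl).

Lemma ho_class_eq (M : CatPair) (A B : M) (x y : word A B) :
  ho_class x = ho_class y <-> word_eq x y.
Proof.
split; intros e.
- apply (f_equal (@proj1_sig _ _)) in e; simpl in e.
  rewrite e; constructor.
- apply subset_eq_compat, functional_extensionality; intros z.
  apply propositional_extensionality; split; intros H.
  + exact (word_eq_trans (word_eq_sym e) H).
  + exact (word_eq_trans e H).
Qed.

Lemma ho_classP (M : CatPair) (A B : M) (f : ho_hom A B) :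
  exists x, f = ho_class x.
Proof.
destruct f as [P [x Px]]; exists x.
apply subset_eq_compat; exact Px.
Qed.

Definition ho_comp (M : CatPair) (A B C : M) (g : ho_hom B C) (f : ho_hom A B) :
  ho_hom A C.
Proof.
exists (fun z => exists x y,
  proj1_sig g x /\ proj1_sig f y /\ word_eq (word_comp x y) z).
destruct g as [P [x Px]], f as [Q [y Qy]]; subst P Q; simpl.
exists (word_comp x y); apply functional_extensionality; intros z.
apply propositional_extensionality; split.
- intros (x' & y' & Hx & Hy & Hz).
  exact (word_eq_trans (word_eq_cong Hx Hy) Hz).
- intros Hz; exists x, y; split; [| split];
  [apply word_eq_refl | apply word_eq_refl | exact Hz].
Defined.

Lemma ho_comp_class (M : CatPair) (A B C : M) (x : word B C) (y : word A B) :
  ho_comp (ho_class x) (ho_class y) = ho_class (word_comp x y).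
Proof.
apply subset_eq_compat; apply functional_extensionality; intros z.
apply propositional_extensionality; split.
- intros (x' & y' & Hx & Hy & Hz).
  exact (word_eq_trans (word_eq_cong Hx Hy) Hz).
- intros Hz; exists x, y; split; [| split];
  [apply word_eq_refl | apply word_eq_refl | exact Hz].
Qed.

Definition ho (M : CatPair) : Category.
Proof.
refine {| Ob := M; hom := @ho_hom M; idm A := ho_class (word_id A);
          comp := @ho_comp M |}.
- intros A B f; destruct (ho_classP f) as [x ->].
  rewrite ho_comp_class; apply ho_class_eq, word_eq_idl.
- intros A B f; destruct (ho_classP f) as [x ->].
  rewrite ho_comp_class; apply ho_class_eq, word_eq_idr.
- intros A B C D h g f.
  destruct (ho_classP f) as [x ->], (ho_classP g) as [y ->],
    (ho_classP h) as [z ->].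
  rewrite !ho_comp_class; apply ho_class_eq, word_eq_assoc.
Defined.

Definition gamma (M : CatPair) : Functor M (ho M).
Proof.
refine {| fobj (A : M) := A : ho M;
          fmap A B f := ho_class (word_map f) : @hom (ho M) A B |}.
- intros A; apply ho_class_eq, word_eq_map_id.
- intros A B C g f; simpl; rewrite ho_comp_class; apply ho_class_eq, word_eq_map_comp.
Defined.

(* The morphism (gamma w)^-1 of ho M; see [ho_inv_l] and [ho_inv_r]. *)
Definition ho_inv (M : CatPair) (A B : M) (w : hom A B) (Hw : weq w) :
  hom (gamma M B) (gamma M A) := ho_class (word_inv Hw).

Lemma ho_inv_l (M : CatPair) (A B : M) (w : hom A B) (Hw : weq w) :
  ho_inv Hw ∘ fmap (gamma M) w = idm (gamma M A).
Proof. simpl; unfold ho_inv; rewrite ho_comp_class; apply ho_class_eq, word_eq_invl. Qed.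

Lemma ho_inv_r (M : CatPair) (A B : M) (w : hom A B) (Hw : weq w) :
  fmap (gamma M) w ∘ ho_inv Hw = idm (gamma M B).
Proof. simpl; unfold ho_inv; rewrite ho_comp_class; apply ho_class_eq, word_eq_invr. Qed.

Section Universal.
Variables (M : CatPair) (C : Category) (F : Functor M C).
Hypothesis F_inv : forall (A B : M) (w : hom A B), weq w -> is_iso (fmap F w).

Let inv A B (w : hom A B) (Hw : weq w) : hom (F B) (F A) :=
  proj1_sig (constructive_indefinite_description _ (F_inv Hw)).

Fixpoint word_lift (A B : M) (x : word A B) : hom (F A) (F B) :=
  match x with
  | word_id A => idm (F A)
  | word_comp x y => word_lift x ∘ word_lift y
  | word_map f => fmap F f
  | word_inv Hw => inv Hw
  end.

Lemma word_lift_eq (A B : M) (x y : word A B) :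
  word_eq x y -> word_lift x = word_lift y.
Proof.
intros e; induction e; simpl; try congruence.
- apply comp_idl.
- apply comp_idr.
- apply comp_assoc.
- apply fmap_id.
- apply fmap_comp.
- unfold inv; destruct constructive_indefinite_description; simpl; tauto.
- unfold inv; destruct constructive_indefinite_description; simpl; tauto.
Qed.

Definition ho_lift_map (A B : M) (f : ho_hom A B) : hom (F A) (F B) :=
  word_lift (proj1_sig (constructive_indefinite_description _ (ho_classP f))).

Lemma ho_lift_class (A B : M) (x : word A B) :
  ho_lift_map (ho_class x) = word_lift x.
Proof.
unfold ho_lift_map; destruct constructive_indefinite_description as [y e]; simpl.
symmetry; apply word_lift_eq, ho_class_eq, e.
Qed.

Definition ho_lift : Functor (ho M) C.
Proof.
refine {| fobj (A : ho M) := F A; fmap A B f := ho_lift_map f |}.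
- intros A; simpl; rewrite ho_lift_class; reflexivity.
- intros A B E g f; simpl.
  destruct (ho_classP f) as [x ->], (ho_classP g) as [y ->].
  rewrite ho_comp_class, !ho_lift_class; reflexivity.
Defined.
End Universal.

Definition arrow_image (C D : Category) (F : Functor C D) (A B : C) (f : hom A B) :
  { X : D & { Y : D & hom X Y } } := existT _ (F A) (existT _ (F B) (fmap F f)).

Lemma Functor_ext (C D : Category) (F G : Functor C D) :
  (forall (A B : C) (f : hom A B), arrow_image F f = arrow_image G f) -> F = G.
Proof.
destruct F as [F0 F1 Fi Fc], G as [G0 G1 Gi Gc]; unfold arrow_image; simpl.
intros e.
assert (e0 : F0 = G0).
{ apply functional_extensionality; intros A.
  exact (f_equal (@projT1 _ _) (e A A (idm A))). }
subst G0.
assert (e1 : F1 = G1).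
{ do 3 (apply functional_extensionality_dep; intro).
  apply (inj_pair2 _ _ _ _ _ (inj_pair2 _ _ _ _ _ (e _ _ _))). }
subst G1; f_equal; apply proof_irrelevance.
Qed.

Lemma iso_inv_unique (C : Category) (A B : C) (f : hom A B) (g h : hom B A) :
  g ∘ f = idm A -> f ∘ h = idm B -> g = h.
Proof.
intros e e'.
rewrite <- (comp_idr g), <- e', comp_assoc, e; apply comp_idl.
Qed.

Lemma gamma_epi (M : CatPair) (C : Category) (G H : Functor (ho M) C) :
  fcomp G (gamma M) = fcomp H (gamma M) -> G = H.
Proof.
destruct G as [G0 G1 Gi Gc], H as [H0 H1 Hi Hc]; intros e.
assert (e0 : G0 = H0) by exact (f_equal (@fobj _ _) e).
subst H0.
assert (em : forall (A B : M) (f : hom A B),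
  G1 A B (fmap (gamma M) f) = H1 A B (fmap (gamma M) f)).
{ intros A B f.
  pose proof (f_equal (fun F => arrow_image F f) e) as E.
  exact (inj_pair2 _ _ _ _ _ (inj_pair2 _ _ _ _ _ E)). }
apply Functor_ext; intros A B f; unfold arrow_image; simpl; do 2 f_equal.
destruct (ho_classP f) as [x ->]; induction x.
- etransitivity; [exact (Gi A) | exact (eq_sym (Hi A))].
- rewrite <- ho_comp_class.
  etransitivity; [apply (Gc A B C0) |].
  etransitivity; [| symmetry; apply (Hc A B C0)].
  rewrite IHx1, IHx2; reflexivity.
- apply em.
- apply iso_inv_unique with (f := G1 A B (fmap (gamma M) w)).
  + etransitivity; [symmetry; apply (Gc A B A) |].
    etransitivity; [| exact (Gi A)].
    f_equal; exact (ho_inv_l w0).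
  + rewrite em.
    etransitivity; [symmetry; apply (Hc B A B) |].
    etransitivity; [| exact (Hi B)].
    f_equal; exact (ho_inv_r w0).
Qed.

Lemma ho_universal (M : CatPair) (C : Category) (F : Functor M C) :
  (forall (A B : M) (w : hom A B), weq w -> is_iso (fmap F w)) ->
  exists! G : Functor (ho M) C, fcomp G (gamma M) = F.
Proof.
intros HF.
assert (e : fcomp (ho_lift HF) (gamma M) = F).
{ apply Functor_ext; intros A B f; unfold arrow_image; simpl.
  rewrite ho_lift_class; reflexivity. }
exists (ho_lift HF); split; [exact e |].
intros G HG; apply gamma_epi; rewrite HG; exact e.
Qed.

(* All triples (i', j', sigma) completing a given pair (f, p). *)
Record LAP2_completion (M' M : CatPair) (t : Functor M' M) (A' B' : M') (B : M)
    (f : hom (t A') B) (p : hom (t B') B) := {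
  lD : M';
  li : hom A' lD;
  lj : hom B' lD;
  lsigma : hom (t lD) B;
  lj_weq : weq lj;
  lsigma_weq : weq lsigma;
  lsigma_li : lsigma ∘ fmap t li = f;
  lsigma_lj : lsigma ∘ fmap t lj = p }.

Record left_approximation (M' M : CatPair) (t : Functor M' M) : Prop := {
  lap_pair : preserves_weq t;
  LAP1 : forall A : M, exists (A' : M') (w : hom (t A') A), weq w;
  LAP2_1 : forall (A' B' : M') (B : M) (f : hom (t A') B) (p : hom (t B') B),
    weq p -> inhabited (LAP2_completion f p);
  LAP2_2 : forall (A' B' : M') (B : M) (f : hom (t A') B) (p : hom (t B') B),
    weq p -> forall x y : LAP2_completion f p,
    ho_inv (lj_weq x) ∘ fmap (gamma M') (li x) =
    ho_inv (lj_weq y) ∘ fmap (gamma M') (li y) }.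

(* All triples (q', p', tau) completing a given pair (f, i). *)
Record RAP2_completion (M' M : CatPair) (t : Functor M' M) (A : M) (A' B' : M')
    (f : hom A (t B')) (i : hom A (t A')) := {
  rS : M';
  rq : hom rS A';
  rp : hom rS B';
  rtau : hom A (t rS);
  rq_weq : weq rq;
  rtau_weq : weq rtau;
  rq_rtau : fmap t rq ∘ rtau = i;
  rp_rtau : fmap t rp ∘ rtau = f }.

Record right_approximation (M' M : CatPair) (t : Functor M' M) : Prop := {
  rap_pair : preserves_weq t;
  RAP1 : forall A : M, exists (A' : M') (w : hom A (t A')), weq w;
  RAP2_1 : forall (A : M) (A' B' : M') (f : hom A (t B')) (i : hom A (t A')),
    weq i -> inhabited (RAP2_completion f i);
  RAP2_2 : forall (A : M) (A' B' : M') (f : hom A (t B')) (i : hom A (t A')),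
    weq i -> forall x y : RAP2_completion f i,
    fmap (gamma M') (rp x) ∘ ho_inv (rq_weq x) =
    fmap (gamma M') (rp y) ∘ ho_inv (rq_weq y) }.

(* (Lu, eps) is terminal among pairs (Lam, Lam gamma => gamma u). *)
Definition total_left_derived (M1 M2 : CatPair) (u : Functor M1 M2)
  (Lu : Functor (ho M1) (ho M2))
  (eps : NatTrans (fcomp Lu (gamma M1)) (fcomp (gamma M2) u)) : Prop :=
  forall (Lam : Functor (ho M1) (ho M2))
    (lam : NatTrans (fcomp Lam (gamma M1)) (fcomp (gamma M2) u)),
  exists! delta : NatTrans Lam Lu, vcomp eps (whisker delta (gamma M1)) = lam.

(* (Ru, eta) is initial among pairs (Lam, gamma u => Lam gamma). *)
Definition total_right_derived (M1 M2 : CatPair) (u : Functor M1 M2)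
  (Ru : Functor (ho M1) (ho M2))
  (eta : NatTrans (fcomp (gamma M2) u) (fcomp Ru (gamma M1))) : Prop :=
  forall (Lam : Functor (ho M1) (ho M2))
    (lam : NatTrans (fcomp (gamma M2) u) (fcomp Lam (gamma M1))),
  exists! delta : NatTrans Ru Lam, vcomp (whisker delta (gamma M1)) eta = lam.

(* Main.v *)
(** Let [F] be the composite of [u] with the localization of [M2], so that
    [F t] inverts weak equivalences. For [f : t A' -> B] and a weak equivalence
    [p : t B' -> B], a completion [(D', i', j', sigma)] gives a "fraction"
    [F(t j')^-1 F(t i')], which LAP2 makes independent of the completion.
    Choosing weak equivalences [p_A : t A' -> A], the fractions of [f p_A] by
    [p_B] are the action on maps of a functor [K] inverting weak equivalences,
    and the maps [F p_A] exhibit [K] as the coreflection of [F] into the functors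
    inverting weak equivalences. Localizing [K] gives [Lu]. The coreflection
    statement does not involve the localization of [M1], so that the right
    derived case follows from it by passing to opposite categories. *)

From Stdlib Require Import ClassicalEpsilon.
Require Import Defs.

Set Implicit Arguments.
Unset Strict Implicit.
Unset Printing Implicit Defensive.

(** * Functors inverting weak equivalences, and cancellation of isomorphisms *)

Definition inverts_weq (M : CatPair) (N : Category) (H : Functor M N) : Prop :=
  forall (A B : M) (w : hom A B), weq w -> is_iso (fmap H w).

Lemma iso_monic (C : Category) (A B X : C) (f : hom A B) (a b : hom X A) :
  is_iso f -> f ∘ a = f ∘ b -> a = b.
Proof.
intros (g & gf & _) e.
rewrite <- (comp_idl a), <- (comp_idl b), <- gf, <- !comp_assoc, e.
reflexivity.
Qed.

Lemma iso_epic (C : Category) (A B X : C) (f : hom A B) (a b : hom B X) :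
  is_iso f -> a ∘ f = b ∘ f -> a = b.
Proof.
intros (g & _ & fg) e.
rewrite <- (comp_idr a), <- (comp_idr b), <- fg, !comp_assoc, e.
reflexivity.
Qed.

Lemma is_iso_fmap (C D : Category) (F : Functor C D) (A B : C) (f : hom A B) :
  is_iso f -> is_iso (fmap F f).
Proof.
intros (g & gf & fg); exists (fmap F g).
rewrite <- !fmap_comp, gf, fg, !fmap_id; split; reflexivity.
Qed.

Lemma NatTrans_eq (C D : Category) (F G : Functor C D) (a b : NatTrans F G) :
  a = b -> forall A, a A = b A.
Proof. intros ->; reflexivity. Qed.

(** * Fractions along a left approximation *)

Section LeftCoreflection.
Variables (M' M : CatPair) (N : Category) (t : Functor M' M) (F : Functor M N).
Hypothesis cover : forall A : M, exists (A' : M') (w : hom (t A') A), weq w.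
Hypothesis completion : forall (A' B' : M') (B : M)
  (f : hom (t A') B) (p : hom (t B') B), weq p -> inhabited (LAP2_completion f p).
Hypothesis Ft_inv : inverts_weq (fcomp F t).
(** The uniqueness clause of LAP2, transported along [F t] and stated in [N] without inverses. In
    this form it dualizes without comparing the localization of an opposite category with the
    opposite of a localization. *)
Hypothesis coherence : forall (A' B' : M') (B : M)
  (f : hom (t A') B) (p : hom (t B') B), weq p ->
  forall (x y : LAP2_completion f p) (a : hom (F (t A')) (F (t B'))),
  fmap F (fmap t (lj x)) ∘ a = fmap F (fmap t (li x)) ->
  fmap F (fmap t (lj y)) ∘ a = fmap F (fmap t (li y)).

(** The equation characterizes F(t j')^-1 F(t i') without choosing an inverse, since F(t j') is
    invertible. *)
Definition fraction (A' B' : M') (B : M) (f : hom (t A') B) (p : hom (t B') B)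
    (a : hom (F (t A')) (F (t B'))) : Prop :=
  exists x : LAP2_completion f p,
    fmap F (fmap t (lj x)) ∘ a = fmap F (fmap t (li x)).

Lemma fraction_exists (A' B' : M') (B : M)
    (f : hom (t A') B) (p : hom (t B') B) :
  weq p -> exists a, fraction f p a.
Proof.
intros Hp; destruct (completion f Hp) as [x].
destruct (Ft_inv (lj_weq x)) as (g & _ & fg); simpl in g, fg.
exists (g ∘ fmap F (fmap t (li x))), x.
rewrite comp_assoc, fg; apply comp_idl.
Qed.

Lemma fraction_unique (A' B' : M') (B : M)
    (f : hom (t A') B) (p : hom (t B') B) a b :
  weq p -> fraction f p a -> fraction f p b -> a = b.
Proof.
intros Hp [x ex] [y ey].
apply (iso_monic (Ft_inv (lj_weq y))); simpl.
rewrite ey; exact (coherence Hp y ex).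
Qed.

Lemma fraction_refl (B' : M') (B : M) (p : hom (t B') B) :
  weq p -> fraction p p (idm _).
Proof.
intros Hp.
assert (e : p ∘ fmap t (idm B') = p) by (rewrite fmap_id; apply comp_idr).
exists {| lj_weq := weq_id B'; lsigma_weq := Hp; lsigma_li := e; lsigma_lj := e |}.
simpl; apply comp_idr.
Qed.

(** A single completion [z] of g sigma against [r], where sigma belongs to the completion of (f, p),
    serves both g f and g p: precompose its first leg with i' or with j'. The two resulting
    completions share their denominator, and coherence lets [b] be computed from the second one. *)
Lemma fraction_comp (A' B' C' : M') (B C : M) (f : hom (t A') B)
    (p : hom (t B') B) (g : hom B C) (r : hom (t C') C) a b :
  weq r -> fraction f p a -> fraction (g ∘ p) r b ->
  fraction (g ∘ f) r (b ∘ a).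
Proof.
intros Hr [x ex] [y ey].
destruct (completion (g ∘ lsigma x) Hr) as [z].
assert (ef : lsigma z ∘ fmap t (li z ∘ li x) = g ∘ f).
{ rewrite fmap_comp, comp_assoc, lsigma_li, <- comp_assoc, lsigma_li.
  reflexivity. }
assert (ep : lsigma z ∘ fmap t (li z ∘ lj x) = g ∘ p).
{ rewrite fmap_comp, comp_assoc, lsigma_li, <- comp_assoc, lsigma_lj.
  reflexivity. }
pose (zf := {| lj_weq := lj_weq z; lsigma_weq := lsigma_weq z;
               lsigma_li := ef; lsigma_lj := lsigma_lj z |}).
pose (zp := {| lj_weq := lj_weq z; lsigma_weq := lsigma_weq z;
               lsigma_li := ep; lsigma_lj := lsigma_lj z |}).
pose proof (coherence Hr zp ey) as eb.
exists zf; simpl in *.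
rewrite comp_assoc, eb, !fmap_comp, <- comp_assoc, ex; reflexivity.
Qed.

(** The inverse is the fraction of [p] by [f]: the two composites are the fractions of [f] by [f]
    and of [p] by [p], which are identities by uniqueness. *)
Lemma fraction_iso (A' B' : M') (B : M) (f : hom (t A') B) (p : hom (t B') B) a :
  weq f -> weq p -> fraction f p a -> is_iso a.
Proof.
intros Hf Hp Ha.
destruct (fraction_exists p Hf) as [b Hb].
exists b; split.
- apply (@fraction_unique _ _ _ f f); [exact Hf | | exact (fraction_refl Hf)].
  rewrite <- (comp_idl f) at 1.
  apply (fraction_comp (p := p)); [exact Hf | exact Ha |].
  rewrite comp_idl; exact Hb.
- apply (@fraction_unique _ _ _ p p); [exact Hp | | exact (fraction_refl Hp)].
  rewrite <- (comp_idl p) at 1.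
  apply (fraction_comp (p := f)); [exact Hp | exact Hb |].
  rewrite comp_idl; exact Ha.
Qed.

(** Both sides factor through F(sigma). Since F(p) may fail to be invertible, this equation need not
    determine [a]; it yields the naturality of the counit. *)
Lemma fraction_denominator (A' B' : M') (B : M)
    (f : hom (t A') B) (p : hom (t B') B) a :
  fraction f p a -> fmap F p ∘ a = fmap F f.
Proof.
intros [[D i j s Hj Hs ef ep] ex]; simpl in ex.
rewrite <- ef, <- ep, !fmap_comp, <- comp_assoc, ex.
reflexivity.
Qed.

(** As [H] inverts sigma, [h] satisfies for [H] the equation that defines [a] for [F]; naturality of
    [lam] at t i' and t j' then compares the two. *)
Lemma fraction_natural (H : Functor M N) (lam : NatTrans H F)
    (A' B' : M') (B : M) (f : hom (t A') B) (p : hom (t B') B) a h :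
  inverts_weq H -> fraction f p a -> fmap H p ∘ h = fmap H f ->
  a ∘ lam (t A') = lam (t B') ∘ h.
Proof.
intros HH [x ex] eh.
assert (eh' : fmap H (fmap t (lj x)) ∘ h = fmap H (fmap t (li x))).
{ apply (iso_monic (HH _ _ _ (lsigma_weq x))).
  rewrite comp_assoc, <- !fmap_comp, lsigma_li, lsigma_lj; exact eh. }
apply (iso_monic (Ft_inv (lj_weq x))); simpl.
rewrite !comp_assoc, ex, <- !naturality, <- comp_assoc, eh'; reflexivity.
Qed.

(** * The coreflection built from chosen weak equivalences p_A, here [rmap A] *)

Let repl (A : M) : M' :=
  proj1_sig (constructive_indefinite_description _ (cover A)).

Let rmap_sig (A : M) : { w : hom (t (repl A)) A | weq w } :=
  constructive_indefinite_description _
    (proj2_sig (constructive_indefinite_description _ (cover A))).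

Let rmap (A : M) : hom (t (repl A)) A := proj1_sig (rmap_sig A).

Let rmap_weq (A : M) : weq (rmap A) := proj2_sig (rmap_sig A).

Let core_sig (A B : M) (f : hom A B) :=
  constructive_indefinite_description _
    (fraction_exists (f ∘ rmap A) (rmap_weq B)).

Definition coreflection : Functor M N.
Proof using completion coherence cover Ft_inv.
refine {| fobj A := F (t (repl A));
          fmap A B f := proj1_sig (core_sig f) |}.
- intros A; destruct (core_sig (idm A)) as [a Ha]; simpl.
  rewrite comp_idl in Ha.
  exact (fraction_unique (rmap_weq A) Ha (fraction_refl (rmap_weq A))).
- intros A B C g f.
  destruct (core_sig f) as [a Ha], (core_sig g) as [b Hb],
    (core_sig (g ∘ f)) as [c Hc]; simpl.
  apply (fraction_unique (rmap_weq C) Hc).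
  rewrite <- comp_assoc; exact (fraction_comp (rmap_weq C) Ha Hb).
Defined.

Lemma coreflection_fraction (A B : M) (f : hom A B) :
  fraction (f ∘ rmap A) (rmap B) (fmap coreflection f).
Proof. exact (proj2_sig (core_sig f)). Qed.

Lemma coreflection_inverts : inverts_weq coreflection.
Proof.
intros A B w Hw.
exact (fraction_iso (weq_comp Hw (rmap_weq A)) (rmap_weq B)
  (coreflection_fraction w)).
Qed.

Definition counit : NatTrans coreflection F.
Proof.
refine {| component A := fmap F (rmap A) : hom (coreflection A) (F A) |}.
intros A B f.
etransitivity; [exact (fraction_denominator (coreflection_fraction f)) |].
exact (fmap_comp F f (rmap A)).
Defined.

(** At t A' the counit is itself the fraction of p_{t A'} by the identity, hence a fraction of two
    weak equivalences. *)
Lemma counit_iso (A' : M') : is_iso (counit (t A')).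
Proof.
destruct (fraction_exists (rmap (t A')) (weq_id (t A'))) as [a Ha].
replace (counit (t A')) with a; simpl.
- exact (fraction_iso (rmap_weq _) (weq_id _) Ha).
- rewrite <- (fraction_denominator Ha), fmap_id; symmetry; apply comp_idl.
Qed.

(** Naturality along p_A forces the component at [A] to be lam_{t A'} H(p_A)^-1, where A' is
    [repl A]. *)
Lemma coreflection_terminal (H : Functor M N) (lam : NatTrans H F) :
  inverts_weq H ->
  exists! d : NatTrans H coreflection, vcomp counit d = lam.
Proof.
intros HH.
pose (inv A := constructive_indefinite_description _ (HH _ _ _ (rmap_weq A))).
assert (nat : forall (A B : M) (f : hom A B),
  (lam (t (repl B)) ∘ proj1_sig (inv B)) ∘ fmap H f =
  fmap coreflection f ∘ (lam (t (repl A)) ∘ proj1_sig (inv A))).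
{ intros A B f; destruct (inv A) as (a & a1 & a2), (inv B) as (b & b1 & b2).
  simpl proj1_sig.
  (* Here [fraction_natural] is used with h = H(p_B)^-1 H(f p_A). *)
  assert (e : fmap coreflection f ∘ lam (t (repl A)) =
              lam (t (repl B)) ∘ (b ∘ fmap H (f ∘ rmap A))).
  { apply (fraction_natural lam HH (coreflection_fraction f)).
    rewrite comp_assoc, b2; apply comp_idl. }
  etransitivity; [| symmetry; apply comp_assoc].
  etransitivity; [| exact (f_equal (fun h => h ∘ a) (eq_sym e))].
  rewrite fmap_comp, <- !comp_assoc, a2, comp_idr; reflexivity. }
pose (delta := @Build_NatTrans M N H coreflection
  (fun A => lam (t (repl A)) ∘ proj1_sig (inv A)) nat).
assert (Hdelta : forall A, counit A ∘ delta A = lam A).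
{ intros A; simpl; destruct (inv A) as (a & a1 & a2); simpl.
  rewrite comp_assoc, <- naturality, <- comp_assoc, a2; apply comp_idr. }
exists delta; split.
- apply NatTrans_ext; exact Hdelta.
- intros d Hd; apply NatTrans_ext; intros A.
  (* Precomposing with H(p_A) and using naturality moves the comparison to t A', where the counit is
     invertible. *)
  apply (iso_epic (HH _ _ _ (rmap_weq A))); rewrite !naturality; f_equal.
  apply (iso_monic (counit_iso (repl A))); rewrite Hdelta.
  symmetry; exact (NatTrans_eq Hd (t (repl A))).
Qed.

Lemma left_coreflection :
  exists (K : Functor M N) (eps : NatTrans K F),
    inverts_weq K /\
    (forall (H : Functor M N) (lam : NatTrans H F), inverts_weq H ->
      exists! d : NatTrans H K, vcomp eps d = lam) /\
    forall A' : M', is_iso (eps (t A')).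
Proof.
exists coreflection, counit; repeat split.
- exact coreflection_inverts.
- exact coreflection_terminal.
- exact counit_iso.
Qed.
End LeftCoreflection.

(** * Opposite categories, functors and transformations *)

Definition op (C : Category) : Category :=
  {| Ob := C; hom A B := @hom C B A; idm A := idm A;
     comp A B D g f := @comp C D B A f g;
     comp_idl A B f := comp_idr f; comp_idr A B f := comp_idl f;
     comp_assoc A B D E h g f := eq_sym (comp_assoc f g h) |}.

Definition op_pair (M : CatPair) : CatPair :=
  {| cat_of := op M; weq A B w := @weq M B A w; weq_id A := weq_id A;
     weq_comp A B C g f Hg Hf := weq_comp Hf Hg |}.

Definition op_fun (C D : Category) (F : Functor C D) : Functor (op C) (op D) :=
  @Build_Functor (op C) (op D) F (fun A B => @fmap C D F B A) (@fmap_id C D F)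
    (fun A B E g f => @fmap_comp C D F E B A f g).

(** Built directly from [F], so that [op (op C)] never has to be identified with [C]. *)
Definition unop_fun (C D : Category) (F : Functor (op C) (op D)) : Functor C D :=
  @Build_Functor C D F (fun A B => @fmap (op C) (op D) F B A)
    (@fmap_id (op C) (op D) F)
    (fun A B E g f => @fmap_comp (op C) (op D) F E B A f g).

Lemma is_iso_op (C : Category) (A B : C) (f : hom A B) :
  is_iso (f : @hom (op C) B A) <-> is_iso f.
Proof. split; intros (g & e & e'); exists g; split; assumption. Qed.

Definition op_nat (C D : Category) (F G : Functor C D) (a : NatTrans F G) :
  NatTrans (op_fun G) (op_fun F) :=
  @Build_NatTrans (op C) (op D) (op_fun G) (op_fun F) a
    (fun A B f => eq_sym (@naturality C D F G a B A f)).

(** * The reflection for right approximations, by duality *)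

Section RightReflection.
Variables (M' M : CatPair) (N : Category) (t : Functor M' M) (F : Functor M N).
Hypothesis cover : forall A : M, exists (A' : M') (w : hom A (t A')), weq w.
Hypothesis completion : forall (A : M) (A' B' : M')
  (f : hom A (t B')) (i : hom A (t A')), weq i -> inhabited (RAP2_completion f i).
Hypothesis Ft_inv : inverts_weq (fcomp F t).
Hypothesis coherence : forall (A : M) (A' B' : M')
  (f : hom A (t B')) (i : hom A (t A')), weq i ->
  forall (x y : RAP2_completion f i) (a : hom (F (t A')) (F (t B'))),
  a ∘ fmap F (fmap t (rq x)) = fmap F (fmap t (rp x)) ->
  a ∘ fmap F (fmap t (rq y)) = fmap F (fmap t (rp y)).

Let top : Functor (op_pair M') (op_pair M) := op_fun t.

(** Passing to opposites turns i', j', sigma into p', q', tau, whence the exchange of [A'] and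
    [B']. *)
Let of_LAP2 (A : M) (A' B' : M') (f : hom A (t B')) (i : hom A (t A'))
    (x : @LAP2_completion (op_pair M') (op_pair M) top B' A' A f i) :
  RAP2_completion f i :=
  {| rS := lD x : M'; rq := lj x; rp := li x; rtau := lsigma x;
     rq_weq := lj_weq x; rtau_weq := lsigma_weq x;
     rq_rtau := lsigma_lj x; rp_rtau := lsigma_li x |}.

Let to_LAP2 (A : M) (A' B' : M') (f : hom A (t B')) (i : hom A (t A'))
    (x : RAP2_completion f i) :
  @LAP2_completion (op_pair M') (op_pair M) top B' A' A f i :=
  @Build_LAP2_completion (op_pair M') (op_pair M) top B' A' A f i
    (rS x) (rp x) (rq x) (rtau x) (rq_weq x) (rtau_weq x) (rp_rtau x) (rq_rtau x).

Lemma right_reflection :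
  exists (K : Functor M N) (eta : NatTrans F K),
    inverts_weq K /\
    (forall (H : Functor M N) (lam : NatTrans F H), inverts_weq H ->
      exists! d : NatTrans K H, vcomp d eta = lam) /\
    forall A' : M', is_iso (eta (t A')).
Proof.
destruct (@left_coreflection (op_pair M') (op_pair M) (op N) top (op_fun F))
  as (K & eps & K_inv & terminal & eps_iso).
- exact cover.
- intros A' B' B f p Hp.
  destruct (completion f Hp) as [x]; exact (inhabits (to_LAP2 x)).
- intros A B w Hw; apply is_iso_op; exact (Ft_inv Hw).
- intros A' B' B f p Hp x y a.
  exact (coherence Hp (x := of_LAP2 x) (of_LAP2 y) (a := a)).
- exists (unop_fun K), (@Build_NatTrans M N F (unop_fun K) eps
    (fun A B f => eq_sym (@naturality (op M) (op N) _ _ eps B A f))).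
  split; [| split].
  + intros A B w Hw; apply is_iso_op; exact (K_inv B A w Hw).
  + intros H lam HH.
    destruct (terminal (op_fun H) (op_nat lam)) as (d & Hd & d_unique).
    { intros A B w Hw; apply is_iso_op; exact (HH _ _ _ Hw). }
    exists (@Build_NatTrans M N (unop_fun K) H d
      (fun A B f => eq_sym (@naturality (op M) (op N) _ _ d B A f))); split.
    * apply NatTrans_ext; intros A; exact (NatTrans_eq Hd A).
    * intros d' Hd'; apply NatTrans_ext; intros A.
      refine (NatTrans_eq (d_unique (@Build_NatTrans (op M) (op N) (op_fun H) K d'
        (fun A B f => eq_sym (@naturality M N _ _ d' B A f))) _) A).
      apply NatTrans_ext; intros X; exact (NatTrans_eq Hd' X).
  + intros A'; apply is_iso_op; exact (eps_iso A').
Qed.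
End RightReflection.

(** * Functors and natural maps on the localization *)

Lemma gamma_inverts (M : CatPair) : inverts_weq (gamma M).
Proof.
intros A B w Hw; exists (ho_inv Hw).
split; [apply ho_inv_l | apply ho_inv_r].
Qed.

Lemma ho_lift_gamma (M : CatPair) (N : Category) (K : Functor M N)
    (HK : inverts_weq K) (A B : M) (f : hom A B) :
  fmap (ho_lift HK) (fmap (gamma M) f) = fmap K f.
Proof. exact (ho_lift_class HK (word_map f)). Qed.

Lemma natural_at_inverse (C D : Category) (G H : Functor C D) (A B : C)
    (f : hom A B) (g : hom B A) (a : hom (G A) (H A)) (b : hom (G B) (H B)) :
  g ∘ f = idm A -> f ∘ g = idm B ->
  b ∘ fmap G f = fmap H f ∘ a -> a ∘ fmap G g = fmap H g ∘ b.
Proof.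
intros gf fg e.
rewrite <- (comp_idl (a ∘ _)), <- (fmap_id H), <- gf, fmap_comp.
rewrite <- comp_assoc, (comp_assoc (fmap H f)), <- e, <- comp_assoc.
rewrite <- fmap_comp, fg, fmap_id, comp_idr; reflexivity.
Qed.

(** Maps of [M] and formal inverses generate [ho M], and naturality passes to composites and
    inverses: induction on words. *)
Lemma gamma_natural (M : CatPair) (N : Category) (G H : Functor (ho M) N)
    (d : forall A : M, hom (G A) (H A)) :
  (forall (A B : M) (f : hom A B),
    d B ∘ fmap G (fmap (gamma M) f) = fmap H (fmap (gamma M) f) ∘ d A) ->
  forall (A B : ho M) (f : hom A B), d B ∘ fmap G f = fmap H f ∘ d A.
Proof.
intros e A B f; destruct (ho_classP f) as [x ->]; induction x.
- change (d A ∘ fmap G (idm (A : ho M)) = fmap H (idm (A : ho M)) ∘ d A).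
  rewrite !fmap_id, comp_idl; apply comp_idr.
- rewrite <- ho_comp_class.
  change (d C ∘ fmap G ((ho_class x1 : @hom (ho M) B C) ∘ ho_class x2) =
          fmap H ((ho_class x1 : @hom (ho M) B C) ∘ ho_class x2) ∘ d A).
  rewrite !fmap_comp, comp_assoc, IHx1, <- comp_assoc, IHx2.
  apply comp_assoc.
- exact (e A B h).
- exact (natural_at_inverse (ho_inv_l w0) (ho_inv_r w0) (e A B w)).
Qed.

(** * Coherence of fractions from the uniqueness clauses of LAP2 and RAP2 *)

(** The functor on [ho M'] induced by [F t] sends j'^-1 i' to the fraction, so the equality of LAP2
    in [ho M'] passes to [N]. *)
Lemma left_coherence (M' M : CatPair) (N : Category) (t : Functor M' M)
    (F : Functor M N) :
  left_approximation t -> inverts_weq (fcomp F t) ->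
  forall (A' B' : M') (B : M) (f : hom (t A') B) (p : hom (t B') B), weq p ->
  forall (x y : LAP2_completion f p) (a : hom (F (t A')) (F (t B'))),
  fmap F (fmap t (lj x)) ∘ a = fmap F (fmap t (li x)) ->
  fmap F (fmap t (lj y)) ∘ a = fmap F (fmap t (li y)).
Proof.
intros ht HT.
assert (lift_lj : forall (A' B' : M') (B : M)
    (f : hom (t A') B) (p : hom (t B') B) (x : LAP2_completion f p),
  fmap (fcomp F t) (lj x) ∘
    fmap (ho_lift HT) (ho_inv (lj_weq x) ∘ fmap (gamma M') (li x)) =
  fmap (fcomp F t) (li x)).
{ intros; rewrite <- !(ho_lift_gamma HT).
  etransitivity; [symmetry; apply (fmap_comp (ho_lift HT)) |].
  rewrite comp_assoc, ho_inv_r, comp_idl; reflexivity. }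
intros A' B' B f p Hp x y a ea.
(* Cancelling the invertible F(t j') identifies [a] with the image of j'^-1 i'. *)
replace a with
  (fmap (ho_lift HT) (ho_inv (lj_weq x) ∘ fmap (gamma M') (li x))).
- rewrite (LAP2_2 ht Hp x y); exact (lift_lj _ _ _ _ _ y).
- apply (iso_monic (HT _ _ _ (lj_weq x))).
  etransitivity; [exact (lift_lj _ _ _ _ _ x) | symmetry; exact ea].
Qed.

Lemma right_coherence (M' M : CatPair) (N : Category) (t : Functor M' M)
    (F : Functor M N) :
  right_approximation t -> inverts_weq (fcomp F t) ->
  forall (A : M) (A' B' : M') (f : hom A (t B')) (i : hom A (t A')), weq i ->
  forall (x y : RAP2_completion f i) (a : hom (F (t A')) (F (t B'))),
  a ∘ fmap F (fmap t (rq x)) = fmap F (fmap t (rp x)) ->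
  a ∘ fmap F (fmap t (rq y)) = fmap F (fmap t (rp y)).
Proof.
intros ht HT.
assert (lift_rq : forall (A : M) (A' B' : M')
    (f : hom A (t B')) (i : hom A (t A')) (x : RAP2_completion f i),
  fmap (ho_lift HT) (fmap (gamma M') (rp x) ∘ ho_inv (rq_weq x)) ∘
    fmap (fcomp F t) (rq x) =
  fmap (fcomp F t) (rp x)).
{ intros; rewrite <- !(ho_lift_gamma HT).
  etransitivity; [symmetry; apply (fmap_comp (ho_lift HT)) |].
  rewrite <- comp_assoc, ho_inv_l, comp_idr; reflexivity. }
intros A A' B' f i Hi x y a ea.
replace a with
  (fmap (ho_lift HT) (fmap (gamma M') (rp x) ∘ ho_inv (rq_weq x))).
- rewrite (RAP2_2 ht Hi x y); exact (lift_rq _ _ _ _ _ y).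
- apply (iso_epic (HT _ _ _ (rq_weq x))).
  etransitivity; [exact (lift_rq _ _ _ _ _ x) | symmetry; exact ea].
Qed.

(** * From (co)reflections to derived functors *)

(** Natural maps between functors on [ho M1] have the same components as those between their
    restrictions along [gamma], so terminality of [K] transfers to its lift. *)
Lemma left_derived_of_coreflection (M1 M2 : CatPair) (u : Functor M1 M2)
    (K : Functor M1 (ho M2)) (eps : NatTrans K (fcomp (gamma M2) u)) :
  inverts_weq K ->
  (forall (H : Functor M1 (ho M2)) (lam : NatTrans H (fcomp (gamma M2) u)),
    inverts_weq H -> exists! d : NatTrans H K, vcomp eps d = lam) ->
  exists (Lu : Functor (ho M1) (ho M2))
         (eps' : NatTrans (fcomp Lu (gamma M1)) (fcomp (gamma M2) u)),
    total_left_derived eps' /\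
    forall A : M1, is_iso (eps A) -> is_iso (eps' A).
Proof.
intros HK terminal.
(* The lift of [K] restricts to [K] on objects by conversion, but on maps only up to a proved
   equality; components are kept and naturality is proved again. *)
assert (eps_nat : forall (A B : M1) (f : hom A B),
  eps B ∘ fmap (fcomp (ho_lift HK) (gamma M1)) f =
  fmap (fcomp (gamma M2) u) f ∘ eps A).
{ intros A B f; rewrite <- naturality; f_equal; exact (ho_lift_gamma HK f). }
exists (ho_lift HK),
  (@Build_NatTrans _ _ (fcomp (ho_lift HK) (gamma M1)) _ eps eps_nat).
split; [| auto].
intros Lam lam.
destruct (terminal _ lam) as (d & Hd & d_unique).
{ intros A B w Hw; exact (is_iso_fmap Lam (gamma_inverts Hw)). }
assert (d_nat : forall (A B : ho M1) (f : hom A B),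
  d B ∘ fmap Lam f = fmap (ho_lift HK) f ∘ d A).
{ apply (@gamma_natural _ _ Lam (ho_lift HK) d); intros A B f.
  rewrite (ho_lift_gamma HK); exact (naturality d f). }
exists (@Build_NatTrans _ _ Lam (ho_lift HK) d d_nat); split.
- apply NatTrans_ext; intros A; exact (NatTrans_eq Hd A).
- intros d' Hd'; apply NatTrans_ext; intros A.
  (* Restricted along [gamma], the competitor [d'] becomes a natural map into [K], to which the
     uniqueness of [d] applies. *)
  assert (d'_nat : forall (A B : M1) (f : hom A B),
    d' B ∘ fmap (fcomp Lam (gamma M1)) f = fmap K f ∘ d' A).
  { intros X Y f; rewrite <- (ho_lift_gamma HK).
    exact (naturality d' (fmap (gamma M1) f)). }
  refine (NatTrans_eq (d_unique
    (@Build_NatTrans _ _ (fcomp Lam (gamma M1)) K d' d'_nat) _) A).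
  apply NatTrans_ext; intros X; exact (NatTrans_eq Hd' X).
Qed.

Lemma right_derived_of_reflection (M1 M2 : CatPair) (u : Functor M1 M2)
    (K : Functor M1 (ho M2)) (eta : NatTrans (fcomp (gamma M2) u) K) :
  inverts_weq K ->
  (forall (H : Functor M1 (ho M2)) (lam : NatTrans (fcomp (gamma M2) u) H),
    inverts_weq H -> exists! d : NatTrans K H, vcomp d eta = lam) ->
  exists (Ru : Functor (ho M1) (ho M2))
         (eta' : NatTrans (fcomp (gamma M2) u) (fcomp Ru (gamma M1))),
    total_right_derived eta' /\
    forall A : M1, is_iso (eta A) -> is_iso (eta' A).
Proof.
intros HK initial.
assert (eta_nat : forall (A B : M1) (f : hom A B),
  eta B ∘ fmap (fcomp (gamma M2) u) f =
  fmap (fcomp (ho_lift HK) (gamma M1)) f ∘ eta A).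
{ intros A B f; rewrite naturality; f_equal.
  symmetry; exact (ho_lift_gamma HK f). }
exists (ho_lift HK),
  (@Build_NatTrans _ _ _ (fcomp (ho_lift HK) (gamma M1)) eta eta_nat).
split; [| auto].
intros Lam lam.
destruct (initial _ lam) as (d & Hd & d_unique).
{ intros A B w Hw; exact (is_iso_fmap Lam (gamma_inverts Hw)). }
assert (d_nat : forall (A B : ho M1) (f : hom A B),
  d B ∘ fmap (ho_lift HK) f = fmap Lam f ∘ d A).
{ apply (@gamma_natural _ _ (ho_lift HK) Lam d); intros A B f.
  rewrite (ho_lift_gamma HK); exact (naturality d f). }
exists (@Build_NatTrans _ _ (ho_lift HK) Lam d d_nat); split.
- apply NatTrans_ext; intros A; exact (NatTrans_eq Hd A).
- intros d' Hd'; apply NatTrans_ext; intros A.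
  assert (d'_nat : forall (A B : M1) (f : hom A B),
    d' B ∘ fmap K f = fmap (fcomp Lam (gamma M1)) f ∘ d' A).
  { intros X Y f; rewrite <- (ho_lift_gamma HK).
    exact (naturality d' (fmap (gamma M1) f)). }
  refine (NatTrans_eq (d_unique
    (@Build_NatTrans _ _ K (fcomp Lam (gamma M1)) d' d'_nat) _) A).
  apply NatTrans_ext; intros X; exact (NatTrans_eq Hd' X).
Qed.

(** * Existence of total derived functors along approximations *)

Theorem theorem5p7p1 (M1' M1 M2 : CatPair)
    (t : Functor M1' M1) (u : Functor M1 M2) :
  (left_approximation t -> preserves_weq (fcomp u t) ->
    exists (Lu : Functor (ho M1) (ho M2))
           (eps : NatTrans (fcomp Lu (gamma M1)) (fcomp (gamma M2) u)),
      total_left_derived eps /\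
      forall A' : M1', is_iso (eps (t A')))
  /\
  (right_approximation t -> preserves_weq (fcomp u t) ->
    exists (Ru : Functor (ho M1) (ho M2))
           (eta : NatTrans (fcomp (gamma M2) u) (fcomp Ru (gamma M1))),
      total_right_derived eta /\
      forall A' : M1', is_iso (eta (t A'))).
Proof.
assert (HT : preserves_weq (fcomp u t) ->
  inverts_weq (fcomp (fcomp (gamma M2) u) t)).
{ intros Hut A B w Hw; exact (gamma_inverts (Hut _ _ _ Hw)). }
split; intros ht Hut; specialize (HT Hut).
- destruct (left_coreflection (LAP1 ht) (LAP2_1 ht) HT (left_coherence ht HT))
    as (K & eps & K_inv & terminal & eps_iso).
  destruct (left_derived_of_coreflection K_inv terminal)
    as (Lu & eps' & derived & eps'_iso).
  exists Lu, eps'; auto.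
- destruct (right_reflection (RAP1 ht) (RAP2_1 ht) HT (right_coherence ht HT))
    as (K & eta & K_inv & initial & eta_iso).
  destruct (right_derived_of_reflection K_inv initial)
    as (Ru & eta' & derived & eta'_iso).
  exists Ru, eta'; auto.
Qed.
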